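(* Let $(M,g)$ be a Riemannian 3-manifold, and let $k$ be a smooth vector field on $M$ and $\lambda\in\mathbb{R}$ a constant such that $\mathrm{Ric}+\tfrac12\mathscr{L}_k g=\tfrac{\lambda}{2}g$, i.e. $(M,g,k)$ is a Ricci soliton with constant $\lambda$. If $k$ has unit length, $g(k,k)=1$ on $M$, then either $\lambda>0$ (the Ricci soliton is shrinking), or else $k$ is parallel ($\nabla k=0$) and $(M,g)$ is flat.
   Context: $\mathrm{Ric}$ is the Ricci tensor of $g$, $\nabla$ its Levi-Civita connection, and $\mathscr{L}$ denotes the Lie derivative. A Ricci soliton $(M,g,k)$ with constant $\lambda$ is a Riemannian manifold with a vector field $k$ satisfying $\mathrm{Ric}+\tfrac12\mathscr{L}_k g=\tfrac{\lambda}{2}g$ (note the normalization $\lambda/2$); it is called shrinking, steady, or expanding if $\lambda>0$, $\lambda=0$, or $\lambda<0$, respectively. *)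

(* Defs.v *)
From HB Require Import structures.
From mathcomp Require Import all_boot all_order all_algebra.
From mathcomp Require Import all_classical all_reals all_analysis.

Set Implicit Arguments.
Unset Strict Implicit.
Unset Printing Implicit Defensive.

Import Order.TTheory GRing.Theory Num.Theory.
Import numFieldNormedType.Exports.

Local Open Scope classical_set_scope.
Local Open Scope ring_scope.

Section Coordinates.
Variables (R : realType) (n : nat).
Local Notation V := 'rV[R]_n.

Definition partial (i : 'I_n) (f : V -> R) : V -> R :=
  fun x => 'D_(delta_mx 0 i) f x.

(* Only used for open U, so that none of these conditions depends on the values
   of f outside U. *)
Fixpoint C_on (m : nat) (U : set V) (f : V -> R) : Prop :=
  (forall x, U x -> {for x, continuous f}) /\
  (if m is m'.+1 then
     forall i, (forall x, U x -> derivable f x (delta_mx 0 i)) /\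
               C_on m' U (partial i f)
   else True).

Definition smooth_on (U : set V) (f : V -> R) : Prop := forall m, C_on m U f.

(* In this section a vector field is given by its components X x 0 i in the
   coordinate frame, and a metric by its Gram matrix (g_ij) in that frame.
   For v : V, cst v is the field with constant components v; in particular
   cst (delta_mx 0 i) is the coordinate field d/dx_i. *)

Definition gform (G : 'M[R]_n) (u v : V) : R := (u *m G *m v^T) 0 0.

Definition vder (X : V -> V) (f : V -> R) : V -> R :=
  fun x => \sum_i X x 0 i * partial i f x.

Definition lie_bracket (X Y : V -> V) : V -> V := fun x =>
  \row_l (vder X (fun y => Y y 0 l) x - vder Y (fun y => X y 0 l) x).

Definition christoffel (g : V -> 'M[R]_n) (l i j : 'I_n) (x : V) : R :=
  2^-1 * \sum_m invmx (g x) l m *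
    (partial i (fun y => g y j m) x + partial j (fun y => g y i m) x
     - partial m (fun y => g y i j) x).

(* The Levi-Civita covariant derivative of Y along X. *)
Definition nabla (g : V -> 'M[R]_n) (X Y : V -> V) : V -> V := fun x =>
  \row_l (vder X (fun y => Y y 0 l) x
          + \sum_i \sum_j christoffel g l i j x * X x 0 i * Y x 0 j).

Definition riemann (g : V -> 'M[R]_n) (X Y Z : V -> V) : V -> V := fun x =>
  nabla g X (nabla g Y Z) x - nabla g Y (nabla g X Z) x
  - nabla g (lie_bracket X Y) Z x.

(* Ric(v, w) is the trace of u |-> R(u, v) w. As R is a tensor, u, v and w may
   be extended to fields with constant components. *)
Definition ricci (g : V -> 'M[R]_n) (x v w : V) : R :=
  \sum_i riemann g (cst (delta_mx 0 i)) (cst v) (cst w) x 0 i.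

(* (L_k g)(Y, Z) = k (g(Y, Z)) - g([k, Y], Z) - g(Y, [k, Z]), for Y and Z the
   fields with constant components v and w. *)
Definition lie_metric (k : V -> V) (g : V -> 'M[R]_n) (x v w : V) : R :=
  vder k (fun y => gform (g y) v w) x
  - gform (g x) (lie_bracket k (cst v) x) w
  - gform (g x) v (lie_bracket k (cst w) x).

End Coordinates.

(* The inverse chart is a total function, meaningful only on chart_img. *)
Record chart (R : realType) (n : nat) (M : topologicalType) := Chart {
  chart_dom : set M;
  chart_img : set 'rV[R]_n;
  chart_map : M -> 'rV[R]_n;
  chart_inv : 'rV[R]_n -> M;
  chart_dom_open : open chart_dom;
  chart_img_open : open chart_img;
  chart_map_fun : set_fun chart_dom chart_img chart_map;
  chart_inv_fun : set_fun chart_img chart_dom chart_inv;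
  chart_mapK : {in chart_dom, cancel chart_map chart_inv};
  chart_invK : {in chart_img, cancel chart_inv chart_map};
  chart_map_cont : {within chart_dom, continuous chart_map};
  chart_inv_cont : {within chart_img, continuous chart_inv} }.

Definition transition (R : realType) (n : nat) (M : topologicalType)
  (c d : chart R n M) : 'rV[R]_n -> 'rV[R]_n :=
  fun x => chart_map d (chart_inv c x).

(* The domain, in the coordinates of c, of the transition map from c to d. *)
Definition overlap (R : realType) (n : nat) (M : topologicalType)
  (c d : chart R n M) : set 'rV[R]_n :=
  chart_img c `&` (chart_inv c @^-1` chart_dom d).

Record manifold (R : realType) (n : nat) := Manifold {
  mspace : topologicalType;
  mspace_hausdorff : hausdorff_space mspace;
  mspace_second_countable : @second_countable mspace;
  atlas_index : Type;
  atlas : atlas_index -> chart R n mspace;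
  atlas_cover : forall p : mspace, exists a, chart_dom (atlas a) p;
  atlas_smooth : forall (a b : atlas_index) (i : 'I_n),
    smooth_on (overlap (atlas a) (atlas b))
              (fun x => transition (atlas a) (atlas b) x 0 i) }.

Section Tensors.
Variables (R : realType) (n : nat) (M : manifold R n).
Local Notation V := 'rV[R]_n.
Local Notation img a := (chart_img (atlas (m := M) a)).

(* Smooth tensor fields are given by their components in every chart, subject
   to the usual change of coordinates rule; components outside chart_img are
   meaningless. *)
Record vector_field := VectorField {
  vf :> atlas_index M -> V -> V;
  vf_smooth : forall a (i : 'I_n), smooth_on (img a) (fun x => vf a x 0 i);
  vf_change : forall a b (x : V), overlap (atlas a) (atlas b) x ->
    let tau := transition (atlas a) (atlas b) in
    vf b (tau x) = 'd tau x (vf a x) }.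

Record riemannian_metric := RiemannianMetric {
  metric :> atlas_index M -> V -> 'M[R]_n;
  metric_smooth : forall a (i j : 'I_n),
    smooth_on (img a) (fun x => metric a x i j);
  metric_sym : forall a (x : V), img a x -> (metric a x)^T = metric a x;
  metric_pos : forall a (x : V), img a x ->
    forall v : V, v != 0 -> 0 < gform (metric a x) v v;
  metric_change : forall a b (x : V), overlap (atlas a) (atlas b) x ->
    let tau := transition (atlas a) (atlas b) in
    forall v w : V,
    gform (metric a x) v w = gform (metric b (tau x)) ('d tau x v) ('d tau x w) }.

Variables (g : riemannian_metric) (k : vector_field).

Definition ricci_soliton (lambda : R) : Prop :=
  forall a (x : V), img a x -> forall v w : V,
    ricci (g a) x v w + 2^-1 * lie_metric (k a) (g a) x v w
    = lambda / 2 * gform (g a x) v w.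

Definition unit_length : Prop :=
  forall a (x : V), img a x -> gform (g a x) (k a x) (k a x) = 1.

Definition parallel : Prop :=
  forall a (x : V), img a x -> forall v : V, nabla (g a) (cst v) (k a) x = 0.

Definition flat : Prop :=
  forall a (x : V), img a x -> forall u v w : V,
    riemann (g a) (cst u) (cst v) (cst w) x = 0.

End Tensors.

(* Main.v *)
From HB Require Import structures.
Require Import Defs.
From mathcomp Require Import all_boot all_order all_algebra.
From mathcomp Require Import all_classical all_reals all_analysis.
From mathcomp Require Import ring lra.

Set Implicit Arguments.
Unset Strict Implicit.
Unset Printing Implicit Defensive.

Import Order.TTheory GRing.Theory Num.Theory.
Import numFieldNormedType.Exports.

Local Open Scope classical_set_scope.
Local Open Scope ring_scope.

(** Taking the divergence of the soliton equation and contracting with [k], the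
    contracted second Bianchi identity [dS = 2 div Ric], the trace of the
    equation and the Ricci identity for [k] give [<Delta k, k> + Ric(k, k) = 0].
    Since [|k| = 1], [<Delta k, k> = - |nabla k|^2], while the equation evaluated
    on [(k, k)] gives [Ric(k, k) = lambda / 2]; hence [|nabla k|^2 = lambda / 2].
    So [lambda <= 0] forces [lambda = 0] and [nabla k = 0], whence [Ric = 0],
    which in dimension 3 means that the metric is flat.

    Everything is local.  In a chart, the smooth functions form a commutative
    ring with commuting derivations, in which these identities are purely
    algebraic. *)

(** * Tensors in dimension 3 *)

Section Dimension3.
Local Notation I := 'I_3.
Local Notation o0 := (ord0 : I).
Local Notation o1 := (lift ord0 ord0 : I).
Local Notation o2 := (lift ord0 (lift ord0 ord0) : I).

Lemma sum3E (V : nmodType) (F : I -> V) : \sum_p F p = F o0 + F o1 + F o2.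
Proof. by rewrite !big_ord_recl big_ord0 addr0 addrA. Qed.

(** The pairs ([nx3 p], [nx3 (nx3 p)]) run over a basis of the bivectors: in dimension 3 an
    antisymmetric pair of indices amounts to a single index. *)
Definition nx3 (i : I) : I :=
  if i == o0 then o1 else if i == o1 then o2 else o0.

Definition det3 (A : comPzRingType) (H : I -> I -> A) : A :=
  H o0 o0 * (H o1 o1 * H o2 o2 - H o1 o2 * H o2 o1)
  - H o0 o1 * (H o1 o0 * H o2 o2 - H o1 o2 * H o2 o0)
  + H o0 o2 * (H o1 o0 * H o2 o1 - H o1 o1 * H o2 o0).

Lemma ord3P (P : I -> Prop) : P o0 -> P o1 -> P o2 -> forall i, P i.
Proof.
move=> P0 P1 P2 [[|[|[|//]]] lti].
- by have -> : Ordinal lti = o0 by exact: val_inj.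
- by have -> : Ordinal lti = o1 by exact: val_inj.
- by have -> : Ordinal lti = o2 by exact: val_inj.
Qed.

(** Multiplicativity of the determinant, as a polynomial identity; it provides the inverse of
    [det3 H] that [riem3_eq0] asks for. *)
Lemma det3_mul (A : comPzRingType) (G H : I -> I -> A) :
  (forall i j, \sum_p H i p * G p j = (i == j)%:R) -> det3 H * det3 G = 1.
Proof.
move=> HG; transitivity (det3 (fun i j => \sum_p H i p * G p j)).
  by rewrite /det3 !sum3E; ring.
by rewrite /det3 !HG /=; ring.
Qed.

(* The entries E_pr = L_{p+1,p+2,r+1,r+2} determine L; [key] recovers E from the
   Ricci contraction Rc as 2 det(H) E = 2 H Rc^T H - tr(H Rc) H. *)
Lemma riem3_eq0 (A : comPzRingType) (H : I -> I -> A)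
    (L : I -> I -> I -> I -> A) (u : A) :
  (forall x : A, x + x = 0 -> x = 0) ->
  (forall i j, H i j = H j i) -> det3 H * u = 1 ->
  (forall i j k q, L i j k q = - L j i k q) ->
  (forall i j k q, L i j k q = - L i j q k) ->
  (forall j k, \sum_i \sum_q L i j k q * H q i = 0) ->
  forall i j k q, L i j k q = 0.
Proof.
move=> reg2 Hs Hu La Lb R0.
have Z1 i k q : L i i k q = 0 by apply: reg2; rewrite {2}La subrr.
have Z2 i j k : L i j k k = 0 by apply: reg2; rewrite {2}Lb subrr.
have key p r : 2 * (det3 H * L (nx3 p) (nx3 (nx3 p)) (nx3 r) (nx3 (nx3 r)))
    = 2 * (\sum_j \sum_k H p k * H r j * \sum_i \sum_q L i j k q * H q i)
      - (\sum_j \sum_k H j k * \sum_i \sum_q L i j k q * H q i) * H p r.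
  rewrite /det3 !sum3E !Z1 !Z2.
  move: p r; apply: ord3P; apply: ord3P; rewrite /nx3 /=;
    (* Antisymmetric pairs are put in cyclic order, so that [ring] meets each independent entry of
       [L] once. *)
    rewrite !(La o1 o0) !(La o0 o2) !(La o2 o1);
    rewrite !(Lb _ _ o1 o0) !(Lb _ _ o0 o2) !(Lb _ _ o2 o1);
    rewrite (Hs o1 o0) (Hs o2 o0) (Hs o2 o1);
    ring.
have E0 p r : L (nx3 p) (nx3 (nx3 p)) (nx3 r) (nx3 (nx3 r)) = 0.
  (* [det3 H] is cancelled by its inverse [u], and the factor 2 of [key] by [reg2]. *)
  rewrite -[LHS]mul1r -Hu mulrAC.
  have -> : det3 H * L (nx3 p) (nx3 (nx3 p)) (nx3 r) (nx3 (nx3 r)) = 0.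
    apply: reg2; rewrite -mulr2n -mulr_natl key.
    rewrite big1 ?mulr0 ?sub0r => [|j _]; last first.
      by apply: big1 => k _; rewrite R0 mulr0.
    rewrite big1 ?mul0r ?oppr0 => [//|j _].
    by apply: big1 => k _; rewrite R0 mulr0.
  by rewrite mul0r.
have F p k q : L (nx3 p) (nx3 (nx3 p)) k q = 0.
  have := E0 p o0; have := E0 p o1; have := E0 p o2; rewrite /nx3 /= -/(nx3 _).
  rewrite -!/(nx3 _) => h2 h1 h0.
  move: k q; apply: ord3P; apply: ord3P; rewrite ?Z2 //; rewrite Lb;
    by rewrite ?h0 ?h1 ?h2 oppr0.
move=> i j k q; move: i j; apply: ord3P; apply: ord3P; rewrite ?Z1 //.
- exact: (F o2).
- by rewrite La (F o1) oppr0.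
- by rewrite La (F o2) oppr0.
- exact: (F o0).
- exact: (F o1).
- by rewrite La (F o0) oppr0.
Qed.
End Dimension3.

(** * Tensor calculus over a ring with commuting derivations *)

Section TensorCalculus.
Local Notation I := 'I_3.
Local Notation o0 := (ord0 : I).
Local Notation o1 := (lift ord0 ord0 : I).
Local Notation o2 := (lift ord0 (lift ord0 ord0) : I).

Variables (A : comPzRingType) (D : I -> A -> A).
Hypothesis DD : forall i x y, D i (x + y) = D i x + D i y.
Hypothesis DM : forall i x y, D i (x * y) = D i x * y + x * D i y.
Hypothesis DC : forall i j x, D i (D j x) = D j (D i x).

Lemma D0 i : D i 0 = 0.
Proof. by apply: (addrI (D i 0)); rewrite -DD !addr0. Qed.

Lemma D1 i : D i 1 = 0.
Proof. by apply: (addrI (D i 1)); rewrite addr0 -{3}[1]mulr1 DM mulr1 mul1r. Qed.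

Lemma DN i x : D i (- x) = - D i x.
Proof. by apply: (addrI (D i x)); rewrite -DD !subrr D0. Qed.

Lemma Dnat i (b : bool) : D i b%:R = 0.
Proof. by case: b; rewrite ?D0 ?D1. Qed.

Lemma Dsum i (J : finType) (F : J -> A) : D i (\sum_p F p) = \sum_p D i (F p).
Proof. by apply: (big_morph (D i)); [exact: DD|exact: D0]. Qed.

Let DE := (DD, DN, DM).

(* [Gam l i j] is the Christoffel symbol with upper index l; [G] is the metric
   and [H] its inverse. *)
Variables (Gam : I -> I -> I -> A) (G H : I -> I -> A).
(** [GamC] and [DG] are the properties that characterize the Levi-Civita connection: it is torsion
    free and the metric is parallel. *)
Hypothesis GamC : forall l i j, Gam l i j = Gam l j i.
Hypothesis Gsym : forall i j, G i j = G j i.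
Hypothesis Hsym : forall i j, H i j = H j i.
Hypothesis HG : forall i j, \sum_p H i p * G p j = (i == j)%:R.
Hypothesis DG : forall i j l,
  D i (G j l) = \sum_p (Gam p i j * G p l + Gam p i l * G p j).

(* The l-th component of R(d_i, d_j) d_k. *)
Definition curv (i j k l : I) : A :=
  D i (Gam l j k) - D j (Gam l i k)
  + \sum_p (Gam p j k * Gam l i p - Gam p i k * Gam l j p).

Definition ric (j k : I) : A := \sum_i curv i j k i.

Definition scal : A := \sum_j \sum_k H j k * ric j k.

(* Covariant derivatives: the direction m comes first; [T i j] has two lower
   indices in [nab2], and [T i l] has upper index l in [nab11]. *)
Definition ncurv (m i j k l : I) : A :=
  D m (curv i j k l)
  - \sum_p (Gam p m i * curv p j k l + Gam p m j * curv i p k l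
            + Gam p m k * curv i j p l - Gam l m p * curv i j k p).

Definition nab2 (T : I -> I -> A) (m i j : I) : A :=
  D m (T i j) - \sum_p (Gam p m i * T p j + Gam p m j * T i p).

Definition nab11 (T : I -> I -> A) (m i l : I) : A :=
  D m (T i l) - \sum_p (Gam p m i * T p l - Gam l m p * T i p).

(** * Symmetries of the curvature and the second Bianchi identity *)

Lemma curvC i j k l : curv i j k l = - curv j i k l.
Proof. rewrite /curv !sum3E; ring. Qed.

Lemma ncurvC m i j k l : ncurv m i j k l = - ncurv m j i k l.
Proof.
rewrite /ncurv !sum3E (curvC i j) DE.
rewrite (curvC o0 j) (curvC o1 j) (curvC o2 j) (curvC i o0) (curvC i o1).
rewrite (curvC i o2) !(curvC i j).
ring.
Qed.

(** Once [DC] orders the second derivatives and [GamC] the lower indices, the cyclic sum cancels as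
    a polynomial in the Christoffel symbols and their derivatives. *)
Lemma bianchi2 m i j k l :
  ncurv m i j k l + ncurv i j m k l + ncurv j m i k l = 0.
Proof.
rewrite /ncurv /curv !sum3E !DE !(DC i m) !(DC j m) !(DC j i).
rewrite !(GamC _ i m) !(GamC _ j m) !(GamC _ j i).
ring.
Qed.

(** Expanding D_i D_j g_kq = D_j D_i g_kq with [DG] leaves exactly the two curvature terms: this is
    the Ricci identity for the parallel tensor g. *)
Lemma curv_low_anti i j k q :
  \sum_l curv i j k l * G l q = - \sum_l curv i j q l * G l k.
Proof.
have := DC i j (G k q); rewrite !DG !sum3E !DE !DG !sum3E.
rewrite /curv !sum3E (Gsym o1 o0) (Gsym o2 o0) (Gsym o2 o1) => /eqP.
rewrite -subr_eq0 => /eqP E; apply/eqP; rewrite -subr_eq0 -E; apply/eqP.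
ring.
Qed.

(** * The inverse metric and the contractions of the curvature *)

Lemma GH i j : \sum_p G i p * H p j = (i == j)%:R.
Proof.
rewrite eq_sym -HG; apply: eq_bigr => p _.
by rewrite mulrC Gsym Hsym.
Qed.

Lemma sum_delta (F : I -> A) j : \sum_i F i * (i == j)%:R = F j.
Proof.
rewrite (bigD1 j) //= eqxx mulr1 big1 ?addr0 // => i /negPf->.
by rewrite mulr0.
Qed.

(** The inverse metric is parallel: H G = 1 gives DH = - H (DG) H, and in each half of [DG] a
    product of G and H contracts to the identity. *)
Lemma DH i j l : D i (H j l) = - \sum_p (Gam j i p * H p l + Gam l i p * H p j).
Proof.
have E q : \sum_p D i (H j p) * G p q = - \sum_p H j p * D i (G p q).
  apply/eqP; rewrite -addr_eq0 -big_split /=.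
  under eq_bigr => p _ do rewrite -DM.
  by rewrite -Dsum HG Dnat.
have -> : D i (H j l) = \sum_q (\sum_p D i (H j p) * G p q) * H q l.
  rewrite -[LHS](sum_delta (fun p => D i (H j p))).
  under eq_bigr => p _ do rewrite -GH mulr_sumr.
  rewrite exchange_big /=; apply: eq_bigr => q _.
  by rewrite mulr_suml; apply: eq_bigr => p _; rewrite mulrA.
under eq_bigr => q _ do rewrite E mulNr.
rewrite sumrN; congr (- _).
have L : \sum_q \sum_p \sum_r H j p * (Gam r i p * G r q) * H q l
    = \sum_p Gam l i p * H p j.
  rewrite exchange_big /=; apply: eq_bigr => p _.
  rewrite exchange_big /= -(sum_delta (fun r => Gam r i p) l) mulr_suml.
  apply: eq_bigr => r _; rewrite -GH mulr_sumr mulr_suml.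
  apply: eq_bigr => q _; rewrite (Hsym j p); ring.
have M : \sum_q \sum_p \sum_r H j p * (Gam r i q * G r p) * H q l
    = \sum_p Gam j i p * H p l.
  apply: eq_bigr => q _.
  rewrite exchange_big /= -(sum_delta (fun r => Gam r i q) j) mulr_suml.
  apply: eq_bigr => r _; rewrite eq_sym -HG mulr_sumr mulr_suml.
  apply: eq_bigr => p _; rewrite (Gsym p r); ring.
rewrite big_split /= -L -M addrC -big_split /=; apply: eq_bigr => q _.
rewrite mulr_suml -big_split /=; apply: eq_bigr => p _.
rewrite DG mulr_sumr mulr_suml -big_split /=; apply: eq_bigr => r _.
ring.
Qed.

Lemma curv_raise i j k l :
  curv i j k l = \sum_q (\sum_p curv i j k p * G p q) * H q l.
Proof.
rewrite -[LHS](sum_delta (curv i j k)).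
under eq_bigr => p _ do rewrite -GH mulr_sumr.
rewrite exchange_big /=; apply: eq_bigr => q _.
by rewrite mulr_suml; apply: eq_bigr => p _; rewrite mulrA.
Qed.

(* By antisymmetry of R in its last two indices, this is Ric with an index
   raised. *)
Definition qric (i l : I) : A := \sum_j \sum_k H j k * curv i j k l.

(** Lowering l and exchanging it with k costs a sign, by [curv_low_anti]; the sum over k then leaves
    a trace over j, where [curvC] restores the sign. *)
Lemma qricE i l : qric i l = \sum_q H l q * ric i q.
Proof.
have F j q : \sum_k H j k * (\sum_p curv i j q p * G p k) = curv i j q j.
  rewrite -[RHS](sum_delta (curv i j q)).
  under eq_bigr => k _ do rewrite mulr_sumr.
  rewrite exchange_big /=; apply: eq_bigr => p _.
  rewrite eq_sym -HG mulr_sumr; apply: eq_bigr => k _.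
  by rewrite (Gsym p k) mulrCA.
rewrite /qric.
under eq_bigr => j _.
  under eq_bigr => k _.
    rewrite curv_raise; under eq_bigr => q _ do rewrite curv_low_anti mulNr.
    rewrite mulr_sumr; over.
  rewrite exchange_big /=.
  under eq_bigr => q _.
    under eq_bigr => k _ do rewrite mulrN mulrA.
    rewrite sumrN -mulr_suml F -mulNr -curvC mulrC Hsym; over.
  over.
by rewrite exchange_big /=; apply: eq_bigr => q _; rewrite /ric mulr_sumr.
Qed.

(** In the trace, the Christoffel terms of the upper index and of i cancel. *)
Lemma ncurv_tr m j k : \sum_i ncurv m i j k i = nab2 ric m j k.
Proof. rewrite /ncurv /nab2 /ric !sum3E !DE; ring. Qed.

(** By [DH], contraction with H commutes with the covariant derivative; [nab11_raise] and [Dscal]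
    rest on the same fact. *)
Lemma ncurv_qric m i l :
  \sum_j \sum_k H j k * ncurv m i j k l = nab11 qric m i l.
Proof.
rewrite /ncurv /nab11 /qric !sum3E !DE !DH !sum3E.
rewrite (Hsym o1 o0) (Hsym o2 o0) (Hsym o2 o1).
ring.
Qed.

Lemma nab11_raise m i l : nab11 qric m i l = \sum_q H l q * nab2 ric m i q.
Proof.
rewrite /nab11 /nab2 !sum3E !qricE !sum3E !DE !DH !sum3E.
rewrite -!(Hsym l) (Hsym o1 o0) (Hsym o2 o0) (Hsym o2 o1).
ring.
Qed.

Lemma Dscal i : D i scal = \sum_j \sum_k H j k * nab2 ric i j k.
Proof.
rewrite /scal /nab2 !sum3E !DE !DH !sum3E.
rewrite (Hsym o1 o0) (Hsym o2 o0) (Hsym o2 o1).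
ring.
Qed.

(** The second Bianchi identity is traced over m and the upper index, and over j and k with H; its
    three terms become div Ric, - dS and div Ric. *)
Lemma contracted_bianchi i :
  D i scal = 2 * \sum_j \sum_k H j k * nab2 ric j i k.
Proof.
pose X := \sum_j \sum_k \sum_m H j k *
  (ncurv m i j k m + ncurv i j m k m + ncurv j m i k m).
have X0 : X = 0.
  by rewrite /X; do 3![apply: big1 => ? _]; rewrite bianchi2 mulr0.
have XE : X = \sum_m nab11 qric m i m
    - (\sum_j \sum_k H j k * nab2 ric i j k)
    + \sum_j \sum_k H j k * nab2 ric j i k.
  under [\sum_m nab11 _ _ _ _]eq_bigr => m _ do rewrite -ncurv_qric.
  under [X in _ = _ - X + _]eq_bigr => j _.
    under eq_bigr => k _ do rewrite -ncurv_tr mulr_sumr.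
    over.
  under [X in _ = _ + X]eq_bigr => j _.
    under eq_bigr => k _ do rewrite -ncurv_tr mulr_sumr.
    over.
  rewrite exchange_big /=.
  under [X in _ = X - _ + _]eq_bigr => j _ do rewrite exchange_big /=.
  rewrite -sumrB -big_split; apply: eq_bigr => j _ /=.
  rewrite -sumrB -big_split; apply: eq_bigr => k _ /=.
  rewrite -sumrB -big_split; apply: eq_bigr => m _ /=.
  by rewrite (ncurvC i j) mulrDr mulrDr mulrN.
move: XE; rewrite X0 -Dscal.
under eq_bigr => m _ do rewrite nab11_raise.
move=> /esym/eqP; rewrite addrAC subr_eq0 => /eqP<-.
ring.
Qed.

(** * Covariant derivatives of fields with constant components *)

Definition covd (X Y : I -> A) (l : I) : A :=
  \sum_i X i * D i (Y l) + \sum_i \sum_j Gam l i j * X i * Y j.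

Lemma covd2 (u v w : I -> A) l :
  (forall i j, D i (v j) = 0) -> (forall i j, D i (w j) = 0) ->
  covd u (covd v w) l = \sum_i \sum_j \sum_h
    u i * v j * w h * (D i (Gam l j h) + \sum_p Gam p j h * Gam l i p).
Proof.
move=> Dv Dw.
have E m : covd v w m = \sum_j \sum_h v j * w h * Gam m j h.
  rewrite /covd big1 ?add0r => [|i _]; last by rewrite Dw mulr0.
  by apply: eq_bigr => j _; apply: eq_bigr => h _; rewrite -mulrA mulrC.
rewrite {1}/covd -big_split; apply: eq_bigr => i _ /=; rewrite E Dsum.
under [X in _ + X]eq_bigr => p _ do rewrite E mulr_sumr.
rewrite [X in _ + X]exchange_big mulr_sumr -big_split; apply: eq_bigr => j _ /=.
under [X in _ + X]eq_bigr => p _ do rewrite mulr_sumr.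
rewrite [X in _ + X]exchange_big Dsum mulr_sumr -big_split.
apply: eq_bigr => h _ /=; rewrite !DM Dv Dw [in RHS]mulrDr [in RHS]mulr_sumr.
congr (_ + _).
  ring.
by apply: eq_bigr => p _; ring.
Qed.

(** Fields with constant components commute, so R(u, v) w has no bracket term. *)
Lemma covd_curv (u v w : I -> A) l :
  (forall i j, D i (u j) = 0) -> (forall i j, D i (v j) = 0) ->
  (forall i j, D i (w j) = 0) ->
  covd u (covd v w) l - covd v (covd u w) l
  = \sum_i \sum_j \sum_h u i * v j * w h * curv i j h l.
Proof.
move=> Du Dv Dw; rewrite !covd2 // [X in _ - X]exchange_big -sumrB /=.
apply: eq_bigr => i _; rewrite -sumrB; apply: eq_bigr => j _; rewrite -sumrB.
by apply: eq_bigr => h _; rewrite /curv sumrB; ring.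
Qed.

(** * The covariant derivative of a vector field *)

Variable k : I -> A.

Definition nabk (i l : I) : A := D i (k l) + \sum_p Gam l i p * k p.

Definition divk : A := \sum_i nabk i i.

Definition gnabk (i j : I) : A := \sum_l nabk i l * G l j.

Definition normnabk : A :=
  \sum_i \sum_j H i j * \sum_l \sum_q nabk i l * G l q * nabk j q.

(** The Ricci identity for k; as [Gam] is symmetric, no first-order term remains. *)
Lemma nab11_nabkC i j l :
  nab11 nabk i j l = nab11 nabk j i l + \sum_p curv i j p l * k p.
Proof.
rewrite /nab11 /nabk /curv !sum3E !DE (DC i j) !(GamC _ j i).
ring.
Qed.

Lemma nab11_nabk_tr j : \sum_m nab11 nabk m j m = D j divk + \sum_p ric j p * k p.
Proof.
under eq_bigr => m _ do rewrite nab11_nabkC.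
rewrite big_split /=; congr (_ + _).
  rewrite /nab11 /divk !sum3E !DE; ring.
rewrite exchange_big /=; apply: eq_bigr => p _.
by rewrite /ric mulr_suml.
Qed.

Lemma nab2_gnabk m i j : nab2 gnabk m i j = \sum_l nab11 nabk m i l * G l j.
Proof.
rewrite /nab2 /nab11 /gnabk !sum3E !DE !DG !sum3E.
rewrite (Gsym o1 o0) (Gsym o2 o0) (Gsym o2 o1); ring.
Qed.

Lemma nab2_metric m i j : nab2 G m i j = 0.
Proof.
rewrite /nab2 DG !sum3E (Gsym i o0) (Gsym i o1) (Gsym i o2); ring.
Qed.

(** Metric compatibility turns the derivatives of g into Christoffel symbols, which the symmetry of
    [Gam] recombines with the derivatives of k. *)
Lemma lie_metric_gnabk i j :
  \sum_m k m * D m (G i j) + \sum_l D i (k l) * G l j + \sum_l G i l * D j (k l)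
  = gnabk i j + gnabk j i.
Proof.
rewrite /gnabk /nabk !sum3E !DG !sum3E.
rewrite (Gsym i o0) (Gsym i o1) (Gsym i o2).
rewrite !(GamC _ i o0) !(GamC _ i o1) !(GamC _ i o2).
rewrite !(GamC _ j o0) !(GamC _ j o1) !(GamC _ j o2).
ring.
Qed.

Hypothesis reg2 : forall x : A, x + x = 0 -> x = 0.

(** [riem3_eq0] is applied to the curvature with its last index lowered, [det3 G] being the inverse
    of [det3 H]. *)
Lemma ric_flat : (forall i j, ric i j = 0) -> forall i j k l, curv i j k l = 0.
Proof.
move=> ric0 i j h l; rewrite curv_raise big1 // => q _.
rewrite (@riem3_eq0 _ H (fun i j h q => \sum_p curv i j h p * G p q) (det3 G));
  rewrite ?mul0r //.
- exact: det3_mul.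
- move=> a b c d; rewrite -sumrN; apply: eq_bigr => p _.
  by rewrite curvC mulNr.
- by move=> a b c d; exact: curv_low_anti.
- move=> a b; rewrite -[RHS](ric0 a b); apply: eq_bigr => p _.
  by rewrite -curv_raise.
Qed.

(** * Vector fields of unit length *)

Hypothesis kunit : \sum_l \sum_q k l * G l q * k q = 1.

(** Half the derivative of |k|^2 = 1. *)
Lemma nabk_orth i : \sum_l \sum_q nabk i l * G l q * k q = 0.
Proof.
apply: reg2; rewrite -[RHS](D1 i) -kunit /nabk !sum3E !DE !DG !sum3E.
rewrite (Gsym o1 o0) (Gsym o2 o0) (Gsym o2 o1).
ring.
Qed.

(** The covariant derivative of <nabla_i k, k> = 0. *)
Lemma nab11_nabk_orth m i :
  \sum_l \sum_q nab11 nabk m i l * G l q * k q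
  = - \sum_l \sum_q nabk m l * G l q * nabk i q.
Proof.
have E : D m (\sum_l \sum_q nabk i l * G l q * k q)
    - \sum_p Gam p m i * (\sum_l \sum_q nabk p l * G l q * k q) = 0.
  rewrite nabk_orth D0 big1 ?subr0 // => p _; by rewrite nabk_orth mulr0.
apply/eqP; rewrite -addr_eq0; apply/eqP; rewrite -[RHS]E.
(* Only the derivatives of k itself are eliminated; those of nabla k remain atoms for [ring]. *)
have Dk l : D m (k l) = nabk m l - \sum_p Gam l m p * k p.
  by rewrite /nabk addrK.
rewrite /nab11 !sum3E !DE !DG !Dk !sum3E.
rewrite (Gsym o1 o0) (Gsym o2 o0) (Gsym o2 o1).
ring.
Qed.

(** * Consequences of the soliton equation *)

Variable lam : A.
Hypothesis Dlam : forall i, D i lam = 0.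
(** The soliton equation is doubled, since 2 is only assumed regular in [A]. *)
Hypothesis soliton : forall i j,
  2 * ric i j + (gnabk i j + gnabk j i) = lam * G i j.

Lemma H_contract_low (T : I -> I -> A) :
  \sum_j \sum_i H j i * \sum_l T j l * G l i = \sum_j T j j.
Proof.
apply: eq_bigr => j _; rewrite -[RHS](sum_delta (T j)).
under eq_bigr => i _ do rewrite mulr_sumr.
rewrite exchange_big /=; apply: eq_bigr => l _.
rewrite eq_sym -HG mulr_sumr; apply: eq_bigr => i _.
rewrite (Gsym l i); ring.
Qed.

(** Both halves of the Lie derivative have trace div k, and g has trace 3. *)
Lemma soliton_trace : 2 * (scal + divk) = 3 * lam.
Proof.
have E : \sum_i \sum_j H i j * (2 * ric i j + (gnabk i j + gnabk j i))
    = 2 * scal + 2 * divk.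
  rewrite -[divk](H_contract_low nabk) /scal /gnabk !sum3E.
  rewrite (Hsym o1 o0) (Hsym o2 o0) (Hsym o2 o1); ring.
rewrite mulrDr -E.
under eq_bigr => i _.
  under eq_bigr => j _ do rewrite soliton Gsym mulrCA.
  rewrite -mulr_sumr HG eqxx mulr1; over.
rewrite sum3E; ring.
Qed.

(** The divergence of the equation; its right side vanishes because [lam] is constant and g
    parallel. The terms are 2 div Ric, the Laplacian of k with its index lowered, and the divergence
    of the transpose of nabla k. *)
Lemma soliton_div j :
  2 * (\sum_m \sum_i H m i * nab2 ric m j i)
  + \sum_m \sum_i H m i * (\sum_l nab11 nabk m i l * G l j)
  + \sum_m nab11 nabk m j m = 0.
Proof.
have E m i : 2 * nab2 ric m j i + nab2 gnabk m j i + nab2 gnabk m i j = 0.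
  transitivity (lam * nab2 G m j i); last by rewrite nab2_metric mulr0.
  transitivity (nab2 (fun a b => 2 * ric a b + (gnabk a b + gnabk b a)) m j i).
    have D2 : D m 2 = 0 by rewrite mulr2n DD D1 addr0.
    rewrite /nab2 !sum3E !DE ?D2 ?D1; ring.
  rewrite /nab2; under eq_bigr => p _ do rewrite !soliton.
  rewrite soliton DM Dlam !sum3E; ring.
rewrite -(H_contract_low (fun m l => nab11 nabk m j l)).
rewrite mulr_sumr -!big_split /=; apply: big1 => m _.
rewrite mulr_sumr -!big_split /=; apply: big1 => i _.
rewrite -!nab2_gnabk -[RHS](mulr0 (H m i)) -(E m i); ring.
Qed.

Theorem soliton_normnabk : 2 * normnabk = lam.
Proof.
(* The trace of the equation makes S + div k constant. *)
have Dsd j : D j scal + D j divk = 0.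
  apply: reg2; rewrite -DD -DD.
  have -> : scal + divk + (scal + divk) = 3 * lam by rewrite -soliton_trace; ring.
  by rewrite (_ : 3 * lam = lam + lam + lam) ?DD ?Dlam ?addr0 //; ring.
(* The equation on (k, k), where the Lie derivative vanishes because nabla k is orthogonal to k. *)
have R : 2 * (\sum_i \sum_j k i * k j * ric i j) = lam.
  have Z : \sum_i \sum_j k i * k j * gnabk i j = 0.
    apply: big1 => i _.
    transitivity (k i * \sum_l \sum_q nabk i l * G l q * k q).
      rewrite /gnabk !sum3E; ring.
    by rewrite nabk_orth mulr0.
  transitivity (\sum_i \sum_j k i * k j * (lam * G i j)).
    under [RHS]eq_bigr => i _ do under eq_bigr => j _ do rewrite -soliton.
    transitivity (2 * (\sum_i \sum_j k i * k j * ric i j)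
        + 2 * \sum_i \sum_j k i * k j * gnabk i j); first by rewrite Z mulr0 addr0.
    rewrite !sum3E; ring.
  rewrite -[RHS]mulr1 -kunit !sum3E; ring.
have L : \sum_j k j * (\sum_m \sum_i H m i * (\sum_l nab11 nabk m i l * G l j))
    = - normnabk.
  transitivity (\sum_m \sum_i H m i *
      (\sum_l \sum_q nab11 nabk m i l * G l q * k q)).
    under eq_bigr => j _ do rewrite mulr_sumr.
    rewrite exchange_big /=; apply: eq_bigr => m _.
    under eq_bigr => j _ do rewrite mulr_sumr.
    rewrite exchange_big /=; apply: eq_bigr => i _.
    rewrite [in RHS]exchange_big mulr_sumr /=; apply: eq_bigr => q _.
    by rewrite -mulr_suml; ring.
  under eq_bigr => m _ do under eq_bigr => i _ do rewrite nab11_nabk_orth mulrN.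
  by rewrite -sumrN; apply: eq_bigr => m _; rewrite sumrN.
rewrite -R; congr (2 * _); apply/esym/eqP; rewrite -subr_eq0 -L; apply/eqP.
rewrite -big_split; apply: big1 => j _ /=.
(* By the contracted Bianchi and traced Ricci identities this reads dS + Delta k + d(div k) + Ric(k)
   = 0, and the differentials cancel by [Dsd]. *)
have := soliton_div j; rewrite -contracted_bianchi nab11_nabk_tr => E.
rewrite -[RHS](mulr0 (k j)) -[X in _ = _ * X]E.
have -> : \sum_p k j * k p * ric j p = k j * \sum_p ric j p * k p.
  by rewrite mulr_sumr; apply: eq_bigr => p _; ring.
have -> : D j divk = - D j scal by apply/eqP; rewrite -addr_eq0 addrC Dsd.
ring.
Qed.

End TensorCalculus.

(** * Symmetry of second derivatives *)

Section Schwarz.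
Variables (R : realType) (V : normedModType R).
Implicit Types (f : V -> R) (x y u v : V).

(** The difference quotients along the line are those of [f] in direction [u]. *)
Lemma is_derive_line f y u (t : R) : derivable f (y + t *: u) u ->
  is_derive t 1 (fun s : R => f (y + s *: u)) ('D_u f (y + t *: u)).
Proof.
move=> df.
have E : (fun h : R => h^-1 *: (((fun s : R => f (y + s *: u)) \o shift t) (h *: 1)
            - f (y + t *: u)))
       = (fun h : R => h^-1 *: ((f \o shift (y + t *: u)) (h *: u)
            - f (y + t *: u))).
  apply/funext => h /=; congr (_ *: (f _ - _)).
  by rewrite [h *: 1]mulr1 scalerDl addrCA.
by apply: DeriveDef; rewrite /derivable /derive E.
Qed.

Definition diff2 f x u v : R := f (x + u + v) - f (x + u) - (f (x + v) - f x).

Lemma diff2C f x u v : diff2 f x u v = diff2 f x v u.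
Proof. by rewrite /diff2 [x + u + v]addrAC; ring. Qed.

(** The mean value theorem is applied along [u] to the difference of [f] on two opposite sides of
    the parallelogram, then along [v] to the derivative of [f] in direction [u]. *)
Lemma diff2_mvt f x u v (h : R) : 0 < h ->
  (forall s t : R, 0 <= s <= h -> 0 <= t <= h ->
    derivable f (x + s *: u + t *: v) u /\
    derivable ('D_u f) (x + s *: u + t *: v) v) ->
  exists s t : R, [/\ 0 <= s <= h, 0 <= t <= h &
    diff2 f x (h *: u) (h *: v) = h * h * 'D_v ('D_u f) (x + s *: u + t *: v)].
Proof.
move=> h0 df.
have h0h : 0 <= h <= h by apply/andP; split => //; exact: ltW.
have itvoo (s : R) : s \in `]0, h[ -> 0 <= s <= h.
  by rewrite in_itv /= => /andP[/ltW-> /ltW->].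
have itvcc (s : R) : s \in `[0, h] -> 0 <= s <= h by rewrite in_itv.
have h00 : 0 <= (0 : R) <= h by apply/andP; split => //; exact: ltW.
have d1 (s : R) : 0 <= s <= h -> is_derive s 1
    ((fun s : R => f ((x + h *: v) + s *: u)) - (fun s : R => f (x + s *: u)))
    ('D_u f (x + s *: u + h *: v) - 'D_u f (x + s *: u)).
  move=> sh; apply: is_deriveB.
    rewrite addrAC; apply: is_derive_line; rewrite addrAC.
    by have [] := df s h sh h0h.
  by apply: is_derive_line; have [] := df s 0 sh h00; rewrite scale0r addr0.
have [s sh E1] := MVT h0
  (fun s sh => d1 s (itvoo s sh))
  (derivable_within_continuous
    (fun s sh => @ex_derive _ _ _ _ _ _ _ (d1 s (itvcc s sh)))).
have {}sh := itvoo _ sh.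
have d2 (t : R) : 0 <= t <= h -> is_derive t 1
    (fun t : R => 'D_u f ((x + s *: u) + t *: v))
    ('D_v ('D_u f) (x + s *: u + t *: v)).
  by move=> th; apply: is_derive_line; have [] := df s t sh th.
have [t th E2] := MVT h0
  (fun t th => d2 t (itvoo t th))
  (derivable_within_continuous
    (fun t th => @ex_derive _ _ _ _ _ _ _ (d2 t (itvcc t th)))).
exists s, t; split => //; first exact: itvoo.
move: E1 E2; rewrite !fctE subr0 !scale0r !addr0 => E1 E2.
rewrite /diff2 (addrAC x (h *: u)) E1 E2; ring.
Qed.

(** The second difference is symmetric in its two directions, so by [diff2_mvt] both mixed
    derivatives take a common value at points near [x]; continuity brings them within any [e] of
    each other. *)
Lemma deriveC f x u v (U : set V) : open U -> U x ->
  (forall y, U y -> derivable f y u) -> (forall y, U y -> derivable f y v) ->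
  (forall y, U y -> derivable ('D_u f) y v) ->
  (forall y, U y -> derivable ('D_v f) y u) ->
  {for x, continuous ('D_v ('D_u f))} -> {for x, continuous ('D_u ('D_v f))} ->
  'D_v ('D_u f) x = 'D_u ('D_v f) x.
Proof.
move=> oU Ux du dv duv dvu c1 c2.
apply/eqP; rewrite -subr_eq0 -normr_eq0 eq_le normr_ge0 andbT.
apply/ler_addgt0Pr => e e0; rewrite add0r.
have e20 : 0 < e / 2 by rewrite divr_gt0.
move/cvgrPdist_lt: c1 => /(_ _ e20) n1.
move/cvgrPdist_lt: c2 => /(_ _ e20) n2.
have n3 : \forall y \near x, U y by exact: open_nbhs_nbhs.
have /nbhs_ballP[r /= r0 hr] : nbhs x
    (fun y => U y /\ (`|'D_v ('D_u f) x - 'D_v ('D_u f) y| < e / 2 /\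
                      `|'D_u ('D_v f) x - 'D_u ('D_v f) y| < e / 2)).
  exact: filterI n3 (filterI n1 n2).
(* The parallelogram on [h *: u] and [h *: v] then lies in the ball of radius [r]; adding 1 keeps
   the denominator positive when [u = v = 0]. *)
pose h := r / (`|u| + `|v| + 1).
have d0 : 0 < `|u| + `|v| + 1 by rewrite ltr_wpDl // addr_ge0.
have h0 : 0 < h by rewrite divr_gt0.
have inb (s t : R) : 0 <= s <= h -> 0 <= t <= h -> ball x r (x + s *: u + t *: v).
  move=> /andP[s0 sh] /andP[t0 th].
  rewrite -ball_normE /ball_ /= -addrA opprD addrA subrr sub0r normrN.
  apply: (@le_lt_trans _ _ (h * (`|u| + `|v|))).
    rewrite mulrDr (le_trans (ler_normD _ _)) // !normrZ !ger0_norm //.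
    by rewrite lerD // ler_wpM2r.
  by rewrite /h mulrAC ltr_pdivrMr // ltr_pM2l // ltrDl.
have hU (s t : R) : 0 <= s <= h -> 0 <= t <= h -> U (x + s *: u + t *: v).
  by move=> sh th; have [] := hr _ (inb s t sh th).
have [s [t [sh th E]]] := @diff2_mvt f x u v h h0 (fun s t sh th =>
  conj (du _ (hU s t sh th)) (duv _ (hU s t sh th))).
have hU' (s' t' : R) : 0 <= s' <= h -> 0 <= t' <= h -> U (x + s' *: v + t' *: u).
  by move=> sh' th'; rewrite addrAC; exact: hU.
have [s' [t' [sh' th' E']]] := @diff2_mvt f x v u h h0 (fun s t sh th =>
  conj (dv _ (hU' s t sh th)) (dvu _ (hU' s t sh th))).
have close (a b c : R) : `|a - c| < e / 2 -> `|b - c| < e / 2 -> `|a - b| <= e.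
  move=> ac bc; have -> : a - b = (a - c) - (b - c) by ring.
  by rewrite (le_trans (ler_normB _ _)) // [leRHS]splitr lerD // ltW.
have [_ [k1 _]] := hr _ (inb s t sh th).
have [_ [_ k2]] := hr _ (inb t' s' th' sh').
move: E; rewrite diff2C E' => /(mulfI (mulf_neq0 (lt0r_neq0 h0) (lt0r_neq0 h0))).
rewrite (addrAC x) => EE; rewrite -EE in k1.
exact: close k1 k2.
Qed.
End Schwarz.

(** * The ring of smooth functions on an open set *)

Section SmoothOn.
Variables (R : realType) (n : nat) (U : set 'rV[R]_n).
Hypothesis oU : open U.
Local Notation V := 'rV[R]_n.
Implicit Types (f g : V -> R) (m : nat) (i : 'I_n).

Lemma eqon_near f g : (forall x, U x -> f x = g x) ->
  forall x, U x -> \forall y \near x, f y = g y.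
Proof.
move=> fg x Ux; have Un : nbhs x U by exact: open_nbhs_nbhs.
by apply: filterS Un => y; exact: fg.
Qed.

Lemma eqon_partial f g i : (forall x, U x -> f x = g x) ->
  forall x, U x -> partial i f x = partial i g x.
Proof. by move=> fg x Ux; apply: near_eq_derive; exact: eqon_near. Qed.

(** As U is open, continuity and derivatives at its points depend only on values on U. *)
Lemma C_on_eq m f g : (forall x, U x -> f x = g x) -> C_on m U f -> C_on m U g.
Proof.
elim: m f g => [|m IHm] f g fg [cf df]; split => //.
- move=> x Ux; rewrite /prop_for /continuous_at -(fg x Ux).
  exact: cvg_trans (near_eq_cvg (eqon_near fg Ux)) (cf x Ux).
- move=> x Ux; rewrite /prop_for /continuous_at -(fg x Ux).
  exact: cvg_trans (near_eq_cvg (eqon_near fg Ux)) (cf x Ux).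
move=> i; have [di Ci] := df i; split.
  move=> x Ux; apply: near_eq_derivable (di x Ux); exact: eqon_near.
by apply: IHm Ci => x Ux; exact: eqon_partial.
Qed.

Lemma C_onW m f : C_on m.+1 U f -> C_on m U f.
Proof.
elim: m f => [|m IHm] f [cf df]; split => // i.
by have [di /IHm] := df i.
Qed.

Lemma C_on_cst m (c : R) : C_on m U (cst c).
Proof.
elim: m c => [|m IHm] c; split => //; try by move=> x _; exact: cst_continuous.
move=> i; split; first by move=> x _; exact: derivable_cst.
by apply: C_on_eq (IHm 0) => x _; rewrite /partial derive_cst.
Qed.

Lemma C_onD m f g : C_on m U f -> C_on m U g -> C_on m U (f + g).
Proof.
elim: m f g => [|m IHm] f g [cf df] [cg dg]; split => //;
  try by move=> x Ux; apply: continuousD; [exact: cf|exact: cg].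
move=> i; have [df' Cf] := df i; have [dg' Cg] := dg i; split.
  by move=> x Ux; apply: derivableD; [exact: df'|exact: dg'].
apply: C_on_eq (IHm _ _ Cf Cg) => x Ux.
by rewrite /partial deriveD; [|exact: df'|exact: dg'].
Qed.

Lemma C_onM m f g : C_on m U f -> C_on m U g -> C_on m U (f * g).
Proof.
elim: m f g => [|m IHm] f g Hf Hg; have [cf df] := Hf; have [cg dg] := Hg;
  split => //; try by move=> x Ux; apply: continuousM; [exact: cf|exact: cg].
move=> i; have [df' Cf] := df i; have [dg' Cg] := dg i; split.
  by move=> x Ux; apply: derivableM; [exact: df'|exact: dg'].
apply: C_on_eq (C_onD (IHm _ _ (C_onW Hf) Cg) (IHm _ _ (C_onW Hg) Cf)) => x Ux.
by rewrite /partial deriveM; [|exact: df'|exact: dg'].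
Qed.

(** By induction on [m]: the derivative of 1/f is - (1/f)^2 times that of f, where 1/f is already
    known to one order less. *)
Lemma C_onV m f : (forall x, U x -> f x != 0) -> C_on m U f ->
  C_on m U (fun x => (f x)^-1).
Proof.
move=> f0; elim: m => [|m IHm] Hf; have [cf df] := Hf;
  split => //; try by move=> x Ux; apply: continuousV; [exact: f0|exact: cf].
move=> i; have [df' Cf] := df i; split.
  by move=> x Ux; apply: derivableV; [exact: f0|exact: df'].
have CV := IHm (C_onW Hf).
apply: C_on_eq (C_onM (C_onM (C_on_cst m (-1)) (C_onM CV CV)) Cf) => x Ux.
rewrite /partial deriveV; [|exact: f0|exact: df'].
by rewrite !fctE mulN1r expr2 invfM.
Qed.

Lemma smooth_eq f g : (forall x, U x -> f x = g x) ->
  smooth_on U f -> smooth_on U g.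
Proof. by move=> fg sf m; exact: C_on_eq (sf m). Qed.

Lemma smooth_cst (c : R) : smooth_on U (cst c).
Proof. by move=> m; exact: C_on_cst. Qed.

Lemma smoothD f g : smooth_on U f -> smooth_on U g -> smooth_on U (f + g).
Proof. by move=> sf sg m; exact: C_onD. Qed.

Lemma smoothM f g : smooth_on U f -> smooth_on U g -> smooth_on U (f * g).
Proof. by move=> sf sg m; exact: C_onM. Qed.

Lemma smoothV f : (forall x, U x -> f x != 0) ->
  smooth_on U f -> smooth_on U (fun x => (f x)^-1).
Proof. by move=> f0 sf m; exact: C_onV. Qed.

Lemma smooth_partial i f : smooth_on U f -> smooth_on U (partial i f).
Proof. by move=> sf m; have [_ /(_ i)[]] := sf m.+1. Qed.

Lemma smooth_derivable i f x : smooth_on U f -> U x ->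
  derivable f x (delta_mx 0 i).
Proof. by move=> sf; have [_ /(_ i)[+ _]] := sf 1; apply. Qed.

Lemma smooth_continuous f x : smooth_on U f -> U x -> {for x, continuous f}.
Proof. by move=> sf; have [+ _] := sf 0; apply. Qed.

Lemma partialC i j f x : smooth_on U f -> U x ->
  partial i (partial j f) x = partial j (partial i f) x.
Proof.
move=> sf Ux; apply: (deriveC oU Ux) => [y|y|y|y||]; try exact: smooth_derivable;
  try by apply: smooth_derivable; exact: smooth_partial.
  by apply: smooth_continuous Ux; do 2!apply: smooth_partial.
by apply: smooth_continuous Ux; do 2!apply: smooth_partial.
Qed.

Lemma smooth_sum (I : Type) (r : seq I) (F : I -> V -> R) :
  (forall p, smooth_on U (F p)) -> smooth_on U (fun x => \sum_(p <- r) F p x).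
Proof.
move=> sF; elim: r => [|p r IHr].
  by apply: smooth_eq (smooth_cst 0) => x _; rewrite big_nil.
by apply: smooth_eq (smoothD (sF p) IHr) => x _; rewrite big_cons.
Qed.

Lemma smooth_prod (I : Type) (r : seq I) (F : I -> V -> R) :
  (forall p, smooth_on U (F p)) -> smooth_on U (fun x => \prod_(p <- r) F p x).
Proof.
move=> sF; elim: r => [|p r IHr].
  by apply: smooth_eq (smooth_cst 1) => x _; rewrite big_nil.
by apply: smooth_eq (smoothM (sF p) IHr) => x _; rewrite big_cons.
Qed.

Lemma smooth_det q (M : V -> 'M[R]_q) :
  (forall a b, smooth_on U (fun x => M x a b)) -> smooth_on U (fun x => \det (M x)).
Proof.
move=> sM; apply: smooth_sum => s.
by apply: smoothM; [exact: smooth_cst|apply: smooth_prod => i].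
Qed.

(** Cramer's rule. *)
Lemma smooth_invmx p (M : V -> 'M[R]_p) :
  (forall a b, smooth_on U (fun x => M x a b)) ->
  (forall x, U x -> M x \in unitmx) ->
  forall a b, smooth_on U (fun x => invmx (M x) a b).
Proof.
move=> sM uM a b.
have sV : smooth_on U (fun x => (\det (M x))^-1).
  by apply: smoothV (smooth_det sM) => x /uM; rewrite unitmxE unitfE.
have sC : smooth_on U (fun x => cofactor (M x) b a).
  apply: smoothM; first exact: smooth_cst.
  apply: smooth_det => c d; apply: smooth_eq (sM (lift b c) (lift a d)) => x _.
  by rewrite !mxE.
by apply: smooth_eq (smoothM sV sC) => x Ux; rewrite /invmx uM // !mxE.
Qed.

End SmoothOn.

(* Vanishing off U makes Leibniz equality coincide with equality on U; [oU] is
   a parameter because the ring operations depend on it. *)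
Record smf (R : realType) (n : nat) (U : set 'rV[R]_n) (oU : open U) := Smf {
  smf_fun :> 'rV[R]_n -> R;
  smf_smooth : smooth_on U smf_fun;
  smf_out : forall x, ~ U x -> smf_fun x = 0 }.

Section SmoothRing.
Variables (R : realType) (n : nat) (U : set 'rV[R]_n) (oU : open U).
Local Notation V := 'rV[R]_n.
Local Notation smf := (smf oU).
Implicit Types (a b c : smf) (x : V) (i j : 'I_n).

HB.instance Definition _ := gen_eqMixin smf.
HB.instance Definition _ := gen_choiceMixin smf.

Lemma smfP a b : (forall x, U x -> a x = b x) -> a = b.
Proof.
case: a b => [f sf f0] [g sg g0] /= fg.
have E : f = g.
  apply/funext => x; have [/fg//|Ux] := pselect (U x).
  by rewrite f0 ?g0.
by rewrite -{}E in sg g0 *; congr (Smf oU); exact: Prop_irrelevance.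
Qed.

(** Extension by zero needs no regularity at the boundary, as [smooth_on U] ignores values off U. *)
Definition restr (f : V -> R) : V -> R := fun x => if `[< U x >] then f x else 0.

Lemma restrE f x : U x -> restr f x = f x.
Proof. by move=> Ux; rewrite /restr asboolT. Qed.

Lemma restr_out f x : ~ U x -> restr f x = 0.
Proof. by move=> Ux; rewrite /restr asboolF. Qed.

Lemma restr_smooth f : smooth_on U f -> smooth_on U (restr f).
Proof. by apply: smooth_eq => // x Ux; rewrite restrE. Qed.

Definition smf_of f (sf : smooth_on U f) : smf :=
  Smf oU (restr_smooth sf) (@restr_out f).

Lemma smf_ofE f (sf : smooth_on U f) x : U x -> smf_of sf x = f x.
Proof. exact: restrE. Qed.

Definition smf_cst (c : R) : smf := smf_of (smooth_cst oU c).
Definition smf_add (a b : smf) : smf :=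
  smf_of (smoothD oU (smf_smooth a) (smf_smooth b)).
Definition smf_mul (a b : smf) : smf :=
  smf_of (smoothM oU (smf_smooth a) (smf_smooth b)).
Definition smf_opp (a : smf) : smf := smf_mul (smf_cst (-1)) a.

Lemma smf_cstE (c : R) x : U x -> smf_cst c x = c.
Proof. by move=> Ux; rewrite smf_ofE. Qed.

Lemma smf_addE a b x : U x -> smf_add a b x = a x + b x.
Proof. by move=> Ux; rewrite smf_ofE. Qed.

Lemma smf_mulE a b x : U x -> smf_mul a b x = a x * b x.
Proof. by move=> Ux; rewrite smf_ofE. Qed.

Lemma smf_oppE a x : U x -> smf_opp a x = - a x.
Proof. by move=> Ux; rewrite smf_mulE // smf_cstE // mulN1r. Qed.

Let smfE := (smf_cstE, smf_addE, smf_mulE, smf_oppE).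

Fact smf_addA : associative smf_add.
Proof. by move=> a b c; apply: smfP => x Ux; rewrite !smfE // addrA. Qed.

Fact smf_addC : commutative smf_add.
Proof. by move=> a b; apply: smfP => x Ux; rewrite !smfE // addrC. Qed.

Fact smf_add0 : left_id (smf_cst 0) smf_add.
Proof. by move=> a; apply: smfP => x Ux; rewrite !smfE // add0r. Qed.

Fact smf_addN : left_inverse (smf_cst 0) smf_opp smf_add.
Proof.
by move=> a; apply: smfP => x Ux; rewrite !smfE // addNr.
Qed.

HB.instance Definition _ :=
  GRing.isZmodule.Build smf smf_addA smf_addC smf_add0 smf_addN.

Fact smf_mulA : associative smf_mul.
Proof. by move=> a b c; apply: smfP => x Ux; rewrite !smfE // mulrA. Qed.

Fact smf_mulC : commutative smf_mul.
Proof. by move=> a b; apply: smfP => x Ux; rewrite !smfE // mulrC. Qed.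

Fact smf_mul1 : left_id (smf_cst 1) smf_mul.
Proof. by move=> a; apply: smfP => x Ux; rewrite !smfE // mul1r. Qed.

Fact smf_mulDl : left_distributive smf_mul smf_add.
Proof.
by move=> a b c; apply: smfP => x Ux; rewrite !smfE // mulrDl.
Qed.

(** The ring may be trivial: 0 = 1 when U is empty. *)
HB.instance Definition _ :=
  GRing.Zmodule_isComPzRing.Build smf smf_mulA smf_mulC smf_mul1 smf_mulDl.

Lemma smfD a b x : U x -> (a + b) x = a x + b x.
Proof. exact: smf_addE. Qed.

Lemma smfM a b x : U x -> (a * b) x = a x * b x.
Proof. exact: smf_mulE. Qed.

Lemma smfN a x : U x -> (- a) x = - a x.
Proof. exact: smf_oppE. Qed.

Lemma smf0 x : U x -> (0 : smf) x = 0.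
Proof. exact: smf_cstE. Qed.

Lemma smf1 x : U x -> (1 : smf) x = 1.
Proof. exact: smf_cstE. Qed.

Lemma smf_sum (I : Type) (r : seq I) (F : I -> smf) x : U x ->
  (\sum_(p <- r) F p) x = \sum_(p <- r) F p x.
Proof.
move=> Ux; elim: r => [|p r IHr]; first by rewrite !big_nil smf0.
by rewrite !big_cons smfD // IHr.
Qed.

Definition smf_D i a : smf := smf_of (smooth_partial i (smf_smooth a)).

Lemma smf_DE i a (f : V -> R) x : (forall y, U y -> a y = f y) -> U x ->
  smf_D i a x = partial i f x.
Proof. by move=> af Ux; rewrite smf_ofE //; exact: (eqon_partial oU i af Ux). Qed.

Lemma smf_DD i a b : smf_D i (a + b) = smf_D i a + smf_D i b.
Proof.
apply: smfP => x Ux; rewrite smfD // !smf_ofE //.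
rewrite (eqon_partial oU i _ Ux (g := a \+ b)).
  by rewrite /partial deriveD //; exact: smooth_derivable (smf_smooth _) Ux.
by move=> y Uy; rewrite smfD.
Qed.

Lemma smf_DM i a b : smf_D i (a * b) = smf_D i a * b + a * smf_D i b.
Proof.
apply: smfP => x Ux; rewrite smfD // !smfM // !smf_ofE //.
rewrite (eqon_partial oU i _ Ux (g := a \* b)) => [|y Uy]; last by rewrite smfM.
rewrite /partial deriveM; try exact: smooth_derivable (smf_smooth _) Ux.
by rewrite addrC mulrC.
Qed.

Lemma smf_DC i j a : smf_D i (smf_D j a) = smf_D j (smf_D i a).
Proof.
have DE l (y : V) : U y -> smf_D l a y = partial l a y by exact: smf_ofE.
apply: smfP => x Ux.
exact (etrans (smf_DE i (DE j) Ux)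
  (etrans (partialC oU i j (smf_smooth a) Ux) (esym (smf_DE j (DE i) Ux)))).
Qed.

Lemma smf_Dcst i (c : R) : smf_D i (smf_cst c) = 0.
Proof.
apply: smfP => x Ux; rewrite smf0 //.
rewrite (smf_DE i (@smf_cstE c : forall y, U y -> _ = cst c y) Ux).
by rewrite /partial derive_cst.
Qed.

Lemma smf_reg2 a : a + a = 0 -> a = 0.
Proof.
move=> a0; apply: smfP => x Ux; rewrite smf0 //.
have : (a + a) x = 0 by rewrite a0 smf0.
by rewrite smfD // => h; lra.
Qed.

End SmoothRing.

(** * Positive definite forms *)

Section Gform.
Variables (R : realType) (n : nat).
Implicit Types (G : 'M[R]_n) (u v w : 'rV[R]_n).

Lemma gformE G u v : gform G u v = \sum_l \sum_q u 0 l * G l q * v 0 q.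
Proof.
rewrite /gform mxE exchange_big /=; apply: eq_bigr => q _.
by rewrite !mxE mulr_suml.
Qed.

Lemma gform0l G w : gform G 0 w = 0.
Proof. by rewrite /gform !mul0mx mxE. Qed.

Lemma gformDl G u v w : gform G (u + v) w = gform G u w + gform G v w.
Proof. by rewrite /gform !mulmxDl mxE. Qed.

Lemma gformDr G u v w : gform G w (u + v) = gform G w u + gform G w v.
Proof. by rewrite /gform linearD /= mulmxDr mxE. Qed.

Lemma gformZl G (c : R) u w : gform G (c *: u) w = c * gform G u w.
Proof. by rewrite /gform -!scalemxAl mxE. Qed.

Lemma gformZr G (c : R) u w : gform G w (c *: u) = c * gform G w u.
Proof. by rewrite /gform linearZ /= -scalemxAr mxE. Qed.

Lemma gformC G u v : G^T = G -> gform G u v = gform G v u.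
Proof.
by move=> sG; rewrite /gform -[u *m G *m v^T]trmxK mxE !trmx_mul trmxK sG mulmxA.
Qed.

Lemma gform_deltal G i u : gform G (delta_mx 0 i) u = \sum_q G i q * u 0 q.
Proof. by rewrite /gform -rowE mxE; apply: eq_bigr => q _; rewrite !mxE. Qed.

Lemma gform_deltar G i u : gform G u (delta_mx 0 i) = \sum_l u 0 l * G l i.
Proof. by rewrite /gform trmx_delta -colE !mxE. Qed.

Lemma gform_delta G i j : gform G (delta_mx 0 i) (delta_mx 0 j) = G i j.
Proof. by rewrite /gform trmx_delta -colE -rowE !mxE. Qed.

Definition posdef G : Prop := forall v, v != 0 -> 0 < gform G v v.

(** A nonzero vector of the left kernel would be isotropic. *)
Lemma posdef_unit G : posdef G -> G \in unitmx.
Proof.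
move=> pG; rewrite unitmxE unitfE; apply/negP => /det0P[v v0 vG].
by have := pG v v0; rewrite /gform vG mul0mx mxE ltxx.
Qed.

(** The inverse form is the pullback of [G] under the map sending v to v G^-1. *)
Lemma posdef_invmx G : G^T = G -> posdef G -> posdef (invmx G).
Proof.
move=> sG pG v v0; have uG := posdef_unit pG.
have -> : gform (invmx G) v v = gform G (v *m invmx G) (v *m invmx G).
  by rewrite /gform trmx_mul trmx_inv sG mulmxKV // mulmxA.
apply: pG; apply: contra v0 => /eqP vG.
by rewrite -(mulmxKV uG v) vG mul0mx.
Qed.

Lemma posdef_eq0 G u : posdef G -> gform G u u <= 0 -> u = 0.
Proof.
by move=> pG; apply: contraTeq => /pG; rewrite ltNge.
Qed.

Lemma posdef_ge0 G u : posdef G -> 0 <= gform G u u.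
Proof.
move=> pG; have [->|/pG/ltW//] := eqVneq u 0.
by rewrite gform0l.
Qed.
End Gform.

(* By Lagrange's reduction of H to a sum of three squares. *)
Lemma posdef_tr3_eq0 (R : realType) n (H : 'M[R]_3) (G : 'M[R]_n)
    (K : 'I_3 -> 'rV[R]_n) : H^T = H -> G^T = G -> posdef H -> posdef G ->
  \sum_i \sum_j H i j * gform G (K i) (K j) <= 0 -> forall i, K i = 0.
Proof.
move=> sH sG pH pG.
pose o0 : 'I_3 := ord0; pose o1 : 'I_3 := lift ord0 ord0.
pose o2 : 'I_3 := lift ord0 (lift ord0 ord0).
have Hs i j : H i j = H j i by rewrite -[in LHS]sH mxE.
pose a := H o0 o0; pose b := H o0 o1; pose c := H o0 o2.
have pv (f : 'I_3 -> R) i : f i != 0 ->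
    0 < \sum_l \sum_q f l * H l q * f q.
  move=> fi; have := pH (\row_j f j); rewrite gformE.
  under eq_bigr => l _ do under eq_bigr => q _ do rewrite !mxE.
  by apply; apply: contra fi => /eqP/rowP/(_ i); rewrite !mxE => ->.
have a0 : 0 < a.
  have := pH (delta_mx 0 o0); rewrite gform_delta; apply.
  by apply/eqP => /rowP/(_ o0)/eqP; rewrite !mxE eqxx oner_eq0.
(* The entries of the Schur complement of [a] in [H]; [d] below is that of [p] in turn. *)
pose p := H o1 o1 - b * b / a; pose q := H o1 o2 - b * c / a.
pose r := H o2 o2 - c * c / a.
have p0 : 0 < p.
  (* Here and for [d], the test vector annihilates the preceding squares of the reduction and has
     coordinate 1 in the next. *)
  have := pv (fun i => if i == o0 then - (b / a) else if i == o1 then 1 else 0) o1.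
  rewrite /= oner_eq0 => /(_ isT); rewrite !sum3E /= -!/o0 -!/o1 -!/o2.
  rewrite (Hs o1 o0) -/a -/b; congr (0 < _); rewrite /p; field.
  exact: lt0r_neq0.
pose d := r - q * q / p.
have d0 : 0 < d.
  have := pv (fun i => if i == o0 then - (c - b * q / p) / a
     else if i == o1 then - (q / p) else 1) o2.
  rewrite /= oner_eq0 => /(_ isT); rewrite !sum3E /= -!/o0 -!/o1 -!/o2.
  rewrite (Hs o1 o0) (Hs o2 o0) (Hs o2 o1) -/a -/b -/c.
  have -> : H o1 o1 = p + b * b / a by rewrite /p; ring.
  have -> : H o1 o2 = q + b * c / a by rewrite /q; ring.
  have -> : H o2 o2 = d + q * q / p + c * c / a by rewrite /d /r; ring.
  congr (0 < _); field.
  by rewrite !lt0r_neq0.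
pose X0 := K o0 + (b / a) *: K o1 + (c / a) *: K o2.
pose X1 := K o1 + (q / p) *: K o2.
rewrite sum3E !sum3E -/o0 -/o1 -/o2.
have -> : H o0 o0 * gform G (K o0) (K o0) + H o0 o1 * gform G (K o0) (K o1) +
    H o0 o2 * gform G (K o0) (K o2) +
    (H o1 o0 * gform G (K o1) (K o0) + H o1 o1 * gform G (K o1) (K o1) +
     H o1 o2 * gform G (K o1) (K o2)) +
    (H o2 o0 * gform G (K o2) (K o0) + H o2 o1 * gform G (K o2) (K o1) +
     H o2 o2 * gform G (K o2) (K o2)) =
   a * gform G X0 X0 + p * gform G X1 X1 + d * gform G (K o2) (K o2).
  rewrite /X0 /X1 !(gformDl, gformDr, gformZl, gformZr).
  rewrite (gformC (K o1) (K o0) sG) (gformC (K o2) (K o0) sG).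
  rewrite (gformC (K o2) (K o1) sG) (Hs o1 o0) (Hs o2 o0) (Hs o2 o1) -/a -/b -/c.
  have -> : H o1 o1 = p + b * b / a by rewrite /p; ring.
  have -> : H o1 o2 = q + b * c / a by rewrite /q; ring.
  have -> : H o2 o2 = d + q * q / p + c * c / a by rewrite /d /r; ring.
  field; by rewrite !lt0r_neq0.
move=> le0.
(* Three nonnegative terms with sum at most 0 all vanish; the rows follow by back substitution from
   [K o2]. *)
have n0 := mulr_ge0 (ltW a0) (posdef_ge0 X0 pG).
have n1 := mulr_ge0 (ltW p0) (posdef_ge0 X1 pG).
have n2 := mulr_ge0 (ltW d0) (posdef_ge0 (K o2) pG).
have K2 : K o2 = 0.
  by apply: (posdef_eq0 pG); rewrite -(pmulr_rle0 _ d0); lra.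
have K1 : K o1 = 0.
  have <- : X1 = K o1 by rewrite /X1 K2 scaler0 addr0.
  by apply: (posdef_eq0 pG); rewrite -(pmulr_rle0 _ p0); lra.
have K0 : K o0 = 0.
  have <- : X0 = K o0 by rewrite /X0 K2 K1 !scaler0 !addr0.
  by apply: (posdef_eq0 pG); rewrite -(pmulr_rle0 _ a0); lra.
exact: ord3P.
Qed.

(** * Solitons in a chart *)

Section Christoffel.
Variables (R : realType) (n : nat) (U : set 'rV[R]_n) (g : 'rV[R]_n -> 'M[R]_n).
Hypotheses (oU : open U)
  (sg : forall i j, smooth_on U (fun x => g x i j))
  (symg : forall x, U x -> (g x)^T = g x)
  (ug : forall x, U x -> g x \in unitmx).
Implicit Types (x : 'rV[R]_n) (i j l m : 'I_n).

Lemma g_sym i j x : U x -> g x i j = g x j i.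
Proof. by move=> Ux; rewrite -[in LHS]symg // mxE. Qed.

Lemma partial_g_sym m i j x : U x ->
  partial m (fun y => g y i j) x = partial m (fun y => g y j i) x.
Proof. by apply: eqon_partial => // y; exact: g_sym. Qed.

Lemma ginv_sym i j x : U x -> invmx (g x) i j = invmx (g x) j i.
Proof. by move=> Ux; rewrite -[in LHS](symg Ux) -trmx_inv mxE. Qed.

Lemma ginvM i j x : U x -> \sum_p invmx (g x) i p * g x p j = (i == j)%:R.
Proof.
by move=> Ux; have := mulVmx (ug Ux) => /matrixP/(_ i j); rewrite !mxE.
Qed.

Lemma smooth_christoffel l i j : smooth_on U (christoffel g l i j).
Proof.
apply: smoothM => //; first exact: smooth_cst.
apply: smooth_sum => // m; apply: smoothM => //; first exact: smooth_invmx.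
apply: smoothD => //; first by apply: smoothD => //; exact: smooth_partial.
apply: (smooth_eq oU) (smoothM oU (smooth_cst oU (-1)) (smooth_partial m (sg i j))).
by move=> x _; rewrite !fctE mulN1r.
Qed.

Lemma christoffelC l i j x : U x -> christoffel g l i j x = christoffel g l j i x.
Proof.
move=> Ux; congr (_ * _); apply: eq_bigr => m _; congr (_ * _).
by rewrite (partial_g_sym m i j Ux) [partial i _ _ + _]addrC.
Qed.

Lemma christoffel_low i j l x : U x ->
  \sum_p christoffel g p i j x * g x p l =
  2^-1 * (partial i (fun y => g y j l) x + partial j (fun y => g y i l) x
          - partial l (fun y => g y i j) x).
Proof.
move=> Ux; rewrite /christoffel.
set S := fun m => partial i (fun y => g y j m) x + partial j (fun y => g y i m) x
          - partial m (fun y => g y i j) x.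
rewrite -/(S l).
under eq_bigr => p _ do rewrite -mulrA mulr_suml.
rewrite -mulr_sumr exchange_big /=; congr (_ * _).
rewrite (bigD1 l) //= [X in _ + X]big1 => [|m /negPf ml].
  under eq_bigr => p _ do rewrite mulrAC (ginv_sym _ _ Ux).
  by rewrite -mulr_suml ginvM // eqxx mul1r addr0.
under eq_bigr => p _ do rewrite mulrAC (ginv_sym _ _ Ux).
by rewrite -mulr_suml ginvM // ml mul0r.
Qed.

(** In the sum of the two lowered symbols, all derivatives of g but the one on the left cancel. *)
Lemma christoffel_compat i j l x : U x ->
  partial i (fun y => g y j l) x =
  \sum_p (christoffel g p i j x * g x p l + christoffel g p i l x * g x p j).
Proof.
move=> Ux; rewrite big_split /= !christoffel_low //.
rewrite (partial_g_sym i l j Ux) (partial_g_sym j i l Ux).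
rewrite (partial_g_sym l i j Ux) (partial_g_sym j l i Ux); lra.
Qed.

End Christoffel.

(** * Transfer between pointwise definitions and the ring of smooth functions *)

Section Chart.
Variables (R : realType) (U : set 'rV[R]_3) (g : 'rV[R]_3 -> 'M[R]_3).
Variable k : 'rV[R]_3 -> 'rV[R]_3.
Local Notation V := 'rV[R]_3.
Local Notation I := 'I_3.
Hypotheses (oU : open U)
  (sg : forall i j, smooth_on U (fun x => g x i j))
  (symg : forall x, U x -> (g x)^T = g x)
  (pg : forall x, U x -> posdef (g x))
  (sk : forall i, smooth_on U (fun x => k x 0 i)).

Let ug x (Ux : U x) : g x \in unitmx := posdef_unit (pg Ux).
Local Notation A := (smf oU).
Let D : I -> A -> A := @smf_D _ _ _ oU.
Let gA (i j : I) : A := smf_of oU (sg i j).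
Let hA (i j : I) : A := smf_of oU (smooth_invmx oU sg ug i j).
Let gamA (l i j : I) : A := smf_of oU (smooth_christoffel oU sg ug l i j).
Let kA (i : I) : A := smf_of oU (sk i).
Let cA (v : V) (i : I) : A := smf_cst oU (v 0 i).

Let gAE i j x : U x -> gA i j x = g x i j.
Proof. exact: smf_ofE. Qed.

Let hAE i j x : U x -> hA i j x = invmx (g x) i j.
Proof. exact: smf_ofE. Qed.

Let gamAE l i j x : U x -> gamA l i j x = christoffel g l i j x.
Proof. exact: smf_ofE. Qed.

Let kAE i x : U x -> kA i x = k x 0 i.
Proof. exact: smf_ofE. Qed.

Let cAE v i x : U x -> cA v i x = v 0 i.
Proof. exact: smf_cstE. Qed.

Let DE i (a : A) (f : V -> R) x : (forall y, U y -> a y = f y) -> U x ->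
  D i a x = partial i f x.
Proof. exact: smf_DE. Qed.

Let gamC l i j : gamA l i j = gamA l j i.
Proof. by apply: smfP => x Ux; rewrite !gamAE // (christoffelC oU symg). Qed.

Let gAC i j : gA i j = gA j i.
Proof. by apply: smfP => x Ux; rewrite !gAE // (g_sym symg). Qed.

Let hAC i j : hA i j = hA j i.
Proof. by apply: smfP => x Ux; rewrite !hAE // (ginv_sym symg). Qed.

Let hgA i j : \sum_p hA i p * gA p j = (i == j)%:R.
Proof.
apply: smfP => x Ux; rewrite smf_sum //.
under eq_bigr => p _ do rewrite smfM // hAE // gAE //.
by rewrite (ginvM ug) //; case: eqP; rewrite ?smf1 ?smf0.
Qed.

Let DgA i j l : D i (gA j l) = \sum_p (gamA p i j * gA p l + gamA p i l * gA p j).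
Proof.
apply: smfP => x Ux; rewrite (DE i (gAE j l) Ux) (christoffel_compat oU symg ug) //.
rewrite smf_sum //; apply: eq_bigr => p _.
by rewrite smfD // !smfM // !gamAE // !gAE.
Qed.

(** Agreement on U suffices because partial derivatives are local; hence the lemma can be iterated
    for second covariant derivatives. *)
Lemma nabla_covd (X Y : V -> V) (XA YA : I -> A) :
  (forall x i, U x -> XA i x = X x 0 i) -> (forall x i, U x -> YA i x = Y x 0 i) ->
  forall x l, U x -> covd D gamA XA YA l x = nabla g X Y x 0 l.
Proof.
move=> XE YE x l Ux; rewrite /covd smfD // !smf_sum // mxE.
congr (_ + _).
  apply: eq_bigr => i _; rewrite smfM // XE //; congr (_ * _).
  by apply: DE => // y Uy; rewrite YE.
apply: eq_bigr => i _; rewrite smf_sum //; apply: eq_bigr => j _.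
by rewrite !smfM // gamAE // XE // YE.
Qed.

Lemma vder_cst n (X : 'rV[R]_n -> 'rV[R]_n) (c : R) x : vder X (fun=> c) x = 0.
Proof. by apply: big1 => i _; rewrite /partial derive_cst mulr0. Qed.

Lemma riemann_curv u v w x l : U x ->
  riemann g (cst u) (cst v) (cst w) x 0 l =
  \sum_i \sum_j \sum_h u 0 i * v 0 j * w 0 h * curv D gamA i j h l x.
Proof.
move=> Ux.
have cE (a : V) y i : U y -> cA a i y = cst a y 0 i by move=> Uy; rewrite cAE.
have nE (a b : V) y i : U y ->
    covd D gamA (cA a) (cA b) i y = nabla g (cst a) (cst b) y 0 i.
  by move=> Uy; rewrite (nabla_covd (cE a) (cE b)).
have Dc (a : V) i j : D i (cA a j) = 0 by exact: smf_Dcst.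
have -> : riemann g (cst u) (cst v) (cst w) x 0 l =
  covd D gamA (cA u) (covd D gamA (cA v) (cA w)) l x -
  covd D gamA (cA v) (covd D gamA (cA u) (cA w)) l x.
  rewrite (nabla_covd (cE u) (nE v w)) // (nabla_covd (cE v) (nE u w)) //.
  (* The bracket of constant fields vanishes, and with it the last term of [riemann]. *)
  rewrite /riemann !mxE -[RHS]subr0; congr (_ - _).
  rewrite /vder !big1 ?addr0 // => i _.
    by apply: big1 => j _; rewrite /lie_bracket mxE !vder_cst subr0 mulr0 mul0r.
  by rewrite /lie_bracket mxE !vder_cst subr0 mul0r.
rewrite -smfN // -smfD // covd_curv //; first last.
- exact: smf_DM.
- exact: smf_DD.
rewrite smf_sum //; apply: eq_bigr => i _.
rewrite smf_sum //; apply: eq_bigr => j _.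
rewrite smf_sum //; apply: eq_bigr => h _.
by rewrite !smfM // !cAE.
Qed.

Lemma ricci_ric x j h : U x ->
  ricci g x (delta_mx 0 j) (delta_mx 0 h) = ric D gamA j h x.
Proof.
move=> Ux; rewrite /ricci /ric smf_sum //; apply: eq_bigr => i _.
rewrite riemann_curv // (bigD1 i) //= [X in _ + X]big1 ?addr0; last first.
  move=> a /negPf ai; apply: big1 => b _; apply: big1 => c _.
  by rewrite !mxE eqxx ai !mul0r.
rewrite (bigD1 j) //= [X in _ + X]big1 ?addr0; last first.
  move=> b /negPf bj; apply: big1 => c _.
  by rewrite !mxE eqxx bj mulr0 !mul0r.
rewrite (bigD1 h) //= [X in _ + X]big1 ?addr0; last first.
  by move=> c /negPf ch; rewrite !mxE eqxx ch !mulr0 !mul0r.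
by rewrite !mxE !eqxx !mulr1 mul1r.
Qed.

Lemma lie_metric_delta x i j : U x ->
  lie_metric k g x (delta_mx 0 i) (delta_mx 0 j) =
  (gnabk D gamA gA kA i j + gnabk D gamA gA kA j i) x.
Proof.
move=> Ux; rewrite -(lie_metric_gnabk gamC gAC DgA).
rewrite !smfD // !smf_sum // /lie_metric.
have br a l :
    lie_bracket k (cst (delta_mx 0 a)) x 0 l = - partial a (fun y => k y 0 l) x.
  rewrite /lie_bracket mxE vder_cst sub0r /vder (bigD1 a) //= mxE !eqxx mul1r.
  by rewrite big1 ?addr0 // => b /negPf ba; rewrite mxE eqxx ba mul0r.
rewrite gform_deltar gform_deltal -!sumrN; congr (_ + _ + _).
- apply: eq_bigr => m _; rewrite smfM // kAE //; congr (_ * _).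
  rewrite (DE m (gAE i j) Ux); congr (partial m _ x).
  by apply/funext => y; rewrite gform_delta.
- apply: eq_bigr => l _; rewrite smfM // br mulNr opprK gAE //.
  by rewrite (DE i (kAE l) Ux).
- apply: eq_bigr => l _; rewrite smfM // br mulrN opprK gAE //.
  by rewrite (DE j (kAE l) Ux).
Qed.

Variable lambda : R.
Hypotheses
  (soliton : forall x, U x -> forall v w : V,
    ricci g x v w + 2^-1 * lie_metric k g x v w = lambda / 2 * gform (g x) v w)
  (kunit : forall x, U x -> gform (g x) (k x) (k x) = 1).

Let solitonA i j : 2 * ric D gamA i j
  + (gnabk D gamA gA kA i j + gnabk D gamA gA kA j i) = smf_cst oU lambda * gA i j.
Proof.
apply: smfP => x Ux.
rewrite mulr_natl mulr2n smfD // (smfD (ric _ _ _ _)) // smfM // smf_cstE // gAE //.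
have := soliton Ux (delta_mx 0 i) (delta_mx 0 j).
rewrite ricci_ric // lie_metric_delta // gform_delta => h; lra.
Qed.

Let kunitA : \sum_l \sum_q kA l * gA l q * kA q = 1.
Proof.
apply: smfP => x Ux; rewrite smf1 // -(kunit Ux) gformE smf_sum //.
apply: eq_bigr => l _; rewrite smf_sum //; apply: eq_bigr => q _.
by rewrite !smfM // !kAE // gAE.
Qed.

Let krow x i : V := \row_l nabk D gamA kA i l x.

Let krowE x i l : krow x i 0 l = nabk D gamA kA i l x.
Proof. by rewrite mxE. Qed.

(** [soliton_normnabk] at [x], with |nabla k|^2 in the form that [posdef_tr3_eq0] takes. *)
Lemma unit_soliton_norm x : U x ->
  2 * \sum_i \sum_j invmx (g x) i j *
    gform (g x) (krow x i) (krow x j) = lambda.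
Proof.
move=> Ux.
have E : 2 * normnabk D gamA gA hA kA = smf_cst oU lambda.
  exact: (soliton_normnabk (@smf_DD _ _ _ oU) (@smf_DM _ _ _ oU)
    (@smf_DC _ _ _ oU) gamC gAC hAC hgA DgA (@smf_reg2 _ _ _ oU) kunitA
    (fun i => smf_Dcst oU i lambda) solitonA).
have : (2 * normnabk D gamA gA hA kA) x = lambda by rewrite E smf_cstE.
rewrite mulr_natl mulr2n smfD // => <-; rewrite mulr_natl mulr2n.
suff -> : \sum_i \sum_j invmx (g x) i j *
    gform (g x) (krow x i) (krow x j)
    = normnabk D gamA gA hA kA x by [].
rewrite /normnabk smf_sum //; apply: eq_bigr => i _.
rewrite smf_sum //; apply: eq_bigr => j _.
rewrite smfM // hAE // smf_sum // gformE; congr (_ * _).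
apply: eq_bigr => l _; rewrite smf_sum //; apply: eq_bigr => q _.
rewrite smfM // smfM //.
by congr (_ * _ * _); [exact: krowE|rewrite gAE|exact: krowE].
Qed.

(** As |nabla k|^2 = lambda / 2 is at most 0, positive definiteness of g and its inverse gives nabla
    k = 0, and then lambda = 0. *)
Lemma unit_soliton_parallel x : U x -> lambda <= 0 ->
  lambda = 0 /\ forall i l, nabk D gamA kA i l x = 0.
Proof.
move=> Ux l0; have E := unit_soliton_norm Ux.
have K0 i : krow x i = 0.
  move: i; apply: (@posdef_tr3_eq0 _ _ (invmx (g x)) (g x) (krow x));
    last by lra.
  - by rewrite trmx_inv symg.
  - exact: symg.
  - exact: posdef_invmx (symg Ux) (pg Ux).
  - exact: pg.
split=> [|i l]; last by rewrite -krowE K0 mxE.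
rewrite -E big1 ?mulr0 // => i _; apply: big1 => j _.
by rewrite K0 gform0l mulr0.
Qed.

Lemma unit_soliton_nabla x v : U x -> lambda <= 0 -> nabla g (cst v) k x = 0.
Proof.
move=> Ux l0; apply/rowP => l; rewrite [RHS]mxE.
have cE y i : U y -> cA v i y = cst v y 0 i by move=> Uy; rewrite cAE.
rewrite -(nabla_covd cE (fun y i Uy => kAE i Uy)) //.
have -> : covd D gamA (cA v) kA l = \sum_i cA v i * nabk D gamA kA i l.
  rewrite /covd -big_split; apply: eq_bigr => i _ /=.
  rewrite /nabk mulrDr mulr_sumr; congr (_ + _); apply: eq_bigr => j _; ring.
rewrite smf_sum // big1 // => i _.
by have [_ K0] := unit_soliton_parallel Ux l0; rewrite smfM // K0 mulr0.
Qed.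

Lemma unit_soliton_flat x u v w : U x -> lambda <= 0 ->
  riemann g (cst u) (cst v) (cst w) x = 0.
Proof.
move=> Ux l0; apply/rowP => l; rewrite [RHS]mxE riemann_curv //.
have l00 : lambda = 0 by have [] := unit_soliton_parallel Ux l0.
(* The vanishing holds at every point of U, hence in the ring, where [ric_flat] applies. *)
have K0 i j : nabk D gamA kA i j = 0.
  by apply: smfP => y Uy; have [_ ->] := unit_soliton_parallel Uy l0; rewrite smf0.
have g0 i j : gnabk D gamA gA kA i j = 0.
  by apply: big1 => a _; rewrite K0 mul0r.
have ric0 i j : ric D gamA i j = 0.
  apply: smf_reg2; rewrite -mulr2n -mulr_natl.
  have := solitonA i j; rewrite !g0 !addr0 => ->; rewrite l00.
  exact: mul0r.
apply: big1 => i _; apply: big1 => j _; apply: big1 => h _.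
rewrite (ric_flat (@smf_DD _ _ _ oU) (@smf_DM _ _ _ oU) (@smf_DC _ _ _ oU)
  gAC hAC hgA DgA (@smf_reg2 _ _ _ oU) ric0) smf0 // mulr0 //.
Qed.
End Chart.

(** * From charts to the manifold *)

Theorem lemma1 (R : realType) (M : manifold R 3) (g : riemannian_metric M)
  (k : vector_field M) (lambda : R)
  (hsoliton : ricci_soliton g k lambda) (hunit : unit_length g k) :
  0 < lambda \/ (parallel g k /\ flat g).
Proof.
have [l0|l0] := ltP 0 lambda; first by left.
right; split=> a x Ux.
  move=> v; exact: (unit_soliton_nabla (@chart_img_open _ _ _ (atlas a))
    (metric_smooth g a) (@Defs.metric_sym _ _ _ g a) (@metric_pos _ _ _ g a)
    (vf_smooth k a) (@hsoliton a) (@hunit a) v Ux l0).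
move=> u v w; exact: (unit_soliton_flat (@chart_img_open _ _ _ (atlas a))
  (metric_smooth g a) (@Defs.metric_sym _ _ _ g a) (@metric_pos _ _ _ g a)
  (vf_smooth k a) (@hsoliton a) (@hunit a) u v w Ux l0).
Qed.
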